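(* Let $\mathbf{k}$ be a commutative ring with unit, $X$ a set and $\Omega$ a semigroup. Then $(\mathrm{DD}(X,\Omega),\{\prec_\omega,\succ_\omega\mid\omega\in\Omega\})$, the $\mathbf{k}$-module spanned by the $X$-decorated $\Omega$-typed planar binary trees with at least two leaves, endowed with the operations defined recursively in the context, is a dendriform family algebra, generated by the set $\{\,|\vee_{x,(1,1)}|\ :\ x\in X\}$ of trees with exactly one internal vertex.
   Context: All binary operations on $\mathbf{k}$-modules are $\mathbf{k}$-bilinear. Dendriform family algebra: a $\mathbf{k}$-module $D$ with binary operations $\{\prec_\omega,\succ_\omega\mid\omega\in\Omega\}$ such that for all $x,y,z\in D$ and $\alpha,\beta\in\Omega$: $(x\prec_\alpha y)\prec_\beta z=x\prec_{\alpha\beta}(y\prec_\beta z+y\succ_\alpha z)$; $(x\succ_\alpha y)\prec_\beta z=x\succ_\alpha(y\prec_\beta z)$; $(x\prec_\beta y+x\succ_\alpha y)\succ_{\alpha\beta}z=x\succ_\alpha(y\succ_\beta z)$. It is generated by a subset $S$ if $D$ is the smallest $\mathbf{k}$-submodule containing $S$ and closed under all $\prec_\omega,\succ_\omega$. Monoid $\Omega^1$: if $\Omega$ has no identity element, $\Omega^1:=\Omega\sqcup\{1\}$ with $1\omega=\omega1=\omega$ and $11=1$; if $\Omega$ has an identity, $\Omega^1:=\Omega$ and $1$ denotes its identity. Trees: for $n\ge 0$, $Y_n$ is the set of planar binary trees with $n+1$ leaves, whose internal vertices are decorated by elements of $X$, whose internal edges (edges joining two internal vertices; neither a leaf nor the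 root edge) are decorated by elements of $\Omega$, and whose leaves are decorated by $1\in\Omega^1$. $Y_0=\{|\}$ where $|$ is the tree with one leaf and no internal vertex. For trees $T,U$, $x\in X$ and $\alpha,\beta\in\Omega^1$ (with $\alpha=1$ if $T=|$ and $\alpha\in\Omega$ otherwise; $\beta=1$ if $U=|$ and $\beta\in\Omega$ otherwise), the grafting $T\vee_{x,(\alpha,\beta)}U$ is the tree obtained by joining the roots of $T$ (on the left) and $U$ (on the right) to a new vertex decorated by $x$ via two new edges decorated by $\alpha$ and $\beta$ respectively. Every tree $T\neq|$ has a unique decomposition $T=T^l\vee_{x,(\alpha,\beta)}T^r$. The depth $\mathrm{dep}(T)$ is the maximal number of internal vertices on a path from the root to a leaf ($\mathrm{dep}(|)=0$). Grafting is extended bilinearly in $T,U$. $\mathrm{DD}(X,\Omega):=\bigoplus_{n\ge1}\mathbf{k}Y_n$. The bilinear operations $\prec_\omega,\succ_\omega$ ($\omega\in\Omega$) are defined recursively on $\mathrm{dep}(T)+\mathrm{dep}(U)$ by: (a) for $\omega\in\Omega$ and $T\in Y_n$ with $n\ge1$: $|\succ_\omega T:=T\prec_\omega|:=T$ and $|\prec_\omega T:=T\succ_\omega|:=0$; the same convention is used for $\omega=1\in\Omega^1$, i.e. $|\succ_1T:=T\prec_1|:=T$ and $|\prec_1T:=T\succ_1|:=0$; (b) for $T=T^l\vee_{x,(\alpha_1,\alpha_2)}T^r$ and $U=U^l\vee_{y,(\beta_1,\beta_2)}U^r$: $$T\prec_\omega U:=T^l\vee_{x,(\alpha_1,\alpha_2\omega)}(T^r\prec_\omega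 U+T^r\succ_{\alpha_2}U),$$ $$T\succ_\omega U:=(T\prec_{\beta_1}U^l+T\succ_\omega U^l)\vee_{y,(\omega\beta_1,\beta_2)}U^r.$$ *)

(* Defs.v *)
From HB Require Import structures.
From mathcomp Require Import all_boot all_order all_algebra.
From mathcomp Require Import finmap.
From mathcomp.multinomials Require Import monalg.
From mathcomp Require Import mathcomp_extra boolp.

Set Implicit Arguments.
Unset Strict Implicit.
Unset Printing Implicit Defensive.

Import GRing.Theory.
Local Open Scope ring_scope.

Section DendriformFamily.
Variables (k : comPzRingType) (Omega : semigroupType) (D : lmodType k).
Variables prec succ : Omega -> D -> D -> D.

Definition bilinear_op (f : D -> D -> D) : Prop :=
  (forall y, linear (fun x => f x y)) /\ (forall x, linear (f x)).

Record dendriform_family_algebra : Prop := DendriformFamilyAlgebra {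
  dfa_prec_bilinear : forall w, bilinear_op (prec w);
  dfa_succ_bilinear : forall w, bilinear_op (succ w);
  dfa_prec_prec : forall (a b : Omega) (x y z : D),
    prec b (prec a x y) z = prec (a * b)%g x (prec b y z + succ a y z);
  dfa_succ_prec : forall (a b : Omega) (x y z : D),
    prec b (succ a x y) z = succ a x (prec b y z);
  dfa_succ_succ : forall (a b : Omega) (x y z : D),
    succ (a * b)%g (prec b x y + succ a x y) z = succ a x (succ b y z)
}.

Record dfa_stable (P : D -> Prop) : Prop := DfaStable {
  dfa_stable0 : P 0;
  dfa_stableZD : forall (c : k) (u v : D), P u -> P v -> P (c *: u + v);
  dfa_stable_prec : forall w (u v : D), P u -> P v -> P (prec w u v);
  dfa_stable_succ : forall w (u v : D), P u -> P v -> P (succ w u v)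
}.

Definition dfa_generated_by (S : D -> Prop) : Prop :=
  forall P : D -> Prop,
    dfa_stable P -> (forall u, S u -> P u) -> forall u, P u.

End DendriformFamily.

Section Unitization.
Variable Omega : semigroupType.

Definition has_identity : Prop :=
  exists e : Omega, forall w : Omega, (e * w)%g = w /\ (w * e)%g = w.

Local Notation carrier d := (if d then (Omega : Type) else option Omega).

Definition unitization : Type := carrier (pselect has_identity).

HB.instance Definition _ := gen_eqMixin unitization.
HB.instance Definition _ := gen_choiceMixin unitization.

Definition unitization_embed : Omega -> unitization :=
  match pselect has_identity as d
    return Omega -> carrier d with
  | left _ => fun w => w
  | right _ => fun w => Some w
  end.

Definition unitization_one : unitization :=
  match pselect has_identity as d
    return carrier d with
  | left e_id => sval (cid e_id)
  | right _ => None
  end.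

Definition unitization_mul : unitization -> unitization -> unitization :=
  match pselect has_identity as d
    return carrier d -> carrier d -> carrier d with
  | left _ => fun v w => (v * w)%g
  | right _ => fun v w =>
      match v, w with
      | None, _ => w
      | _, None => v
      | Some v', Some w' => Some (v' * w')%g
      end
  end.

Fact unitization_mulA : associative unitization_mul.
Proof.
rewrite /unitization_mul /unitization; case: pselect => [_|_] /=.
  exact: mulgA.
by move=> [u|] [v|] [w|] //=; rewrite mulgA.
Qed.

Fact unitization_mul1 : left_id unitization_one unitization_mul.
Proof.
rewrite /unitization_mul /unitization_one /unitization.
by case: pselect => [h|_] //= w; case: (cid h) => e /= /(_ w) [].
Qed.

Fact unitization_mulr1 : right_id unitization_one unitization_mul.
Proof.
rewrite /unitization_mul /unitization_one /unitization.
case: pselect => [h|_] //= w; last by case: w.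
by case: (cid h) => e /= /(_ w) [].
Qed.

HB.instance Definition _ := isMonoid.Build unitization
  unitization_mulA unitization_mul1 unitization_mulr1.

Lemma unitization_embedM (v w : Omega) :
  unitization_embed (v * w)%g
    = (unitization_embed v * unitization_embed w)%g.
Proof.
rewrite [RHS]/(unitization_mul _ _) /unitization_mul /unitization_embed.
rewrite /unitization.
by case: pselect.
Qed.

Lemma unitization_embed_inj : injective unitization_embed.
Proof.
rewrite /unitization_embed /unitization.
by case: pselect => [_|_] v w //= [].
Qed.

End Unitization.

Arguments unitization_embed {Omega} w.

(* [Graft x a b T U] is the grafting of T (left) and U (right) on a new vertex
   decorated by x, with edges decorated by a and b. *)
Inductive tree (X O : Type) : Type :=
| Leaf
| Graft of X & O & O & tree X O & tree X O.

Arguments Leaf {X O}.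

HB.instance Definition _ (X O : Type) := gen_eqMixin (tree X O).
HB.instance Definition _ (X O : Type) := gen_choiceMixin (tree X O).

Fixpoint leaves (X O : Type) (T : tree X O) : nat :=
  match T with
  | Leaf => 1%N
  | Graft _ _ _ T1 T2 => (leaves T1 + leaves T2)%N
  end.

Section DecoratedTrees.
Variables (X : Type) (Omega : semigroupType).
Local Notation Omega1 := (unitization Omega).

(* Decorations allowed on the edge joining a vertex to its subtree T; a leaf
   of a tree is the edge above which there is no vertex. *)
Definition edge_decoration (T : tree X Omega1) (a : Omega1) : Prop :=
  match T with
  | Leaf => a = 1%g
  | Graft _ _ _ _ _ => exists w : Omega, a = unitization_embed w
  end.

Fixpoint well_decorated (T : tree X Omega1) : Prop :=
  match T with
  | Leaf => True
  | Graft _ a b T1 T2 =>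
      [/\ edge_decoration T1 a, edge_decoration T2 b,
          well_decorated T1 & well_decorated T2]
  end.

Definition Y (n : nat) (T : tree X Omega1) : Prop :=
  well_decorated T /\ leaves T = n.+1.

End DecoratedTrees.

(* The scaling of [malg] is only available over nontrivial rings. *)
Definition free_module (k : comPzRingType) (B : choiceType) : Type :=
  {malg k[B]}.

Section FreeModule.
Variables (k : comPzRingType) (B : choiceType).

HB.instance Definition _ := GRing.Zmodule.copy (free_module k B) {malg k[B]}.

Definition free_scale (c : k) (u : free_module k B) : free_module k B :=
  [malg b in msupp u => c * u@_b].

Fact free_scaleE c u b : (free_scale c u)@_b = c * u@_b.
Proof. by rewrite mcoeffE; case: msuppP => // _; rewrite mulr0. Qed.

Fact free_scaleA c d u : free_scale c (free_scale d u) = free_scale (c * d) u.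
Proof. by apply/malgP => b; rewrite !free_scaleE mulrA. Qed.

Fact free_scale1 : left_id 1 free_scale.
Proof. by move=> u; apply/malgP => b; rewrite free_scaleE mul1r. Qed.

Fact free_scaleDr : right_distributive free_scale +%R.
Proof.
move=> c u v; apply/malgP => b.
by rewrite free_scaleE !mcoeffD !free_scaleE mulrDr.
Qed.

Fact free_scaleDl u : {morph free_scale^~ u : c d / c + d}.
Proof.
by move=> c d; apply/malgP => b; rewrite free_scaleE mcoeffD !free_scaleE mulrDl.
Qed.

HB.instance Definition _ := GRing.Zmodule_isLmodule.Build k (free_module k B)
  free_scaleA free_scale1 free_scaleDr free_scaleDl.

Definition free_basis (b : B) : free_module k B := << 1 *g b >>.

End FreeModule.

Arguments free_basis {k B} b.

Definition bilinear_extension (k : comPzRingType) (B C E : choiceType)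
    (f : B -> C -> free_module k E)
    (u : free_module k B) (v : free_module k C) : free_module k E :=
  \sum_(b <- msupp u) \sum_(c <- msupp v) (u@_b * v@_c) *: f b c.

Section Operations.
Variables (k : comPzRingType) (X : Type) (Omega : semigroupType).
Local Notation Omega1 := (unitization Omega).
Local Notation tree := (tree X Omega1).
Local Notation kT := (free_module k tree).

Definition graft (x : X) (a b : Omega1) : kT -> kT -> kT :=
  bilinear_extension (fun T U => free_basis (Graft x a b T U)).

(* The pair of functions (w, U) |-> T prec_w U and (w, U) |-> T succ_w U, by
   recursion on T and, T being fixed, on U; see [tree_precE] and [tree_succE]
   below.  The operations on two copies of [Leaf] are undefined in the
   mathematical definition and never used; they are set to 0 here. *)
Fixpoint tree_ops (T : tree) :
    (Omega1 -> tree -> kT) * (Omega1 -> tree -> kT) :=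
  match T with
  | Leaf =>
      (fun w U => 0,
       fun w U => if U is Graft _ _ _ _ _ then free_basis U else 0)
  | Graft x a1 a2 Tl Tr =>
      let prec w U :=
        match U with
        | Leaf => free_basis T
        | Graft _ _ _ _ _ =>
            graft x a1 (a2 * w)%g (free_basis Tl)
              ((tree_ops Tr).1 w U + (tree_ops Tr).2 a2 U)
        end in
      let fix succ w U :=
        match U with
        | Leaf => 0
        | Graft y b1 b2 Ul Ur =>
            graft y (w * b1)%g b2 (prec b1 Ul + succ w Ul) (free_basis Ur)
        end in
      (prec, succ)
  end.

Definition tree_prec (w : Omega1) (T U : tree) : kT := (tree_ops T).1 w U.
Definition tree_succ (w : Omega1) (T U : tree) : kT := (tree_ops T).2 w U.

Lemma tree_prec_leafl w T : tree_prec w Leaf T = 0.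
Proof. by []. Qed.

Lemma tree_succ_leafl w T : T <> Leaf -> tree_succ w Leaf T = free_basis T.
Proof. by case: T. Qed.

Lemma tree_prec_leafr w T : T <> Leaf -> tree_prec w T Leaf = free_basis T.
Proof. by case: T. Qed.

Lemma tree_succ_leafr w T : tree_succ w T Leaf = 0.
Proof. by case: T. Qed.

Lemma tree_precE w x a1 a2 Tl Tr y b1 b2 Ul Ur :
  let T := Graft x a1 a2 Tl Tr in let U := Graft y b1 b2 Ul Ur in
  tree_prec w T U =
    graft x a1 (a2 * w)%g (free_basis Tl) (tree_prec w Tr U + tree_succ a2 Tr U).
Proof. by []. Qed.

Lemma tree_succE w x a1 a2 Tl Tr y b1 b2 Ul Ur :
  let T := Graft x a1 a2 Tl Tr in let U := Graft y b1 b2 Ul Ur in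
  tree_succ w T U =
    graft y (w * b1)%g b2 (tree_prec b1 T Ul + tree_succ w T Ul) (free_basis Ur).
Proof. by []. Qed.

Definition in_DD : {pred kT} :=
  fun u => `[< forall T, T \in msupp u -> exists2 n, (1 <= n)%N & Y n T >].

Lemma in_DDP (u : kT) :
  reflect (forall T, T \in msupp u -> well_decorated T /\ T <> Leaf)
          (u \in in_DD).
Proof.
have leaves_gt0 (T : tree) : (0 < leaves T)%N.
  by elim: T => //= *; rewrite addn_gt0; apply/orP; left.
rewrite unfold_in; apply: (iffP (asboolP _)) => uP T /uP.
  by case=> n n1 [wT lT]; split=> // TL; move: lT n1; rewrite TL => -[<-].
case=> wT TL; exists (leaves T).-1; last by split; rewrite // prednK.
case: T TL {wT} => // x a b Tl Tr _ /=.
by rewrite -ltnS prednK ?addn_gt0 ?leaves_gt0 // -addn1 leq_add.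
Qed.

Fact in_DD_submod_closed : submod_closed in_DD.
Proof.
split=> [|c u v /in_DDP uP /in_DDP vP]; apply/in_DDP => T.
  by rewrite msupp0 inE.
rewrite -mcoeff_neq0 mcoeffD free_scaleE.
case: (msuppP u) => [/uP //|_]; case: (msuppP v) => [/vP //|_].
by rewrite mulr0 addr0 eqxx.
Qed.

HB.instance Definition _ := GRing.isSubmodClosed.Build k kT in_DD
  in_DD_submod_closed.

Record DD : Type := MkDD { DD_val : kT; DD_valP : DD_val \in in_DD }.

HB.instance Definition _ := [isSub for DD_val].
HB.instance Definition _ := [Choice of DD by <:].
HB.instance Definition _ := [SubChoice_isSubLmodule of DD by <:].

Lemma in_DD_basis T : well_decorated T -> T <> Leaf -> free_basis T \in in_DD.
Proof.
move=> wT TL; apply/in_DDP => V.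
rewrite -mcoeff_neq0 mcoeffU; by case: (eqVneq T V) => [<-|_]; rewrite // mulr0n eqxx.
Qed.

Lemma in_DD_bilinear_extension (B C : choiceType) (f : B -> C -> kT) u v :
  (forall b c, b \in msupp u -> c \in msupp v -> f b c \in in_DD) ->
  bilinear_extension f u v \in in_DD.
Proof.
move=> fP; rewrite /bilinear_extension.
rewrite big_seq; apply: rpred_sum => b bu.
by rewrite big_seq; apply: rpred_sum => c cv; apply/rpredZ/fP.
Qed.

Lemma msupp_free_basis (T V : tree) :
  V \in msupp (free_basis T : kT) -> V = T.
Proof. by move=> /(fsubsetP msuppU_le); rewrite inE => /eqP. Qed.

Lemma in_DD_graft x a b u v :
    (forall T, T \in msupp u -> well_decorated T /\ edge_decoration T a) ->
    (forall T, T \in msupp v -> well_decorated T /\ edge_decoration T b) ->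
  graft x a b u v \in in_DD.
Proof.
move=> uP vP; apply: in_DD_bilinear_extension => T U /uP[wT eT] /vP[wU eU].
exact: in_DD_basis.
Qed.

Lemma edge_decoration_mulr (T U : tree) a w :
  edge_decoration T a -> U <> Leaf ->
  edge_decoration U (a * unitization_embed w)%g.
Proof.
case: U => // y b1 b2 Ul Ur; case: T => /= [-> _|_ _ _ _ _ [v ->] _].
  by exists w; rewrite mul1g.
by exists (v * w)%g; rewrite unitization_embedM.
Qed.

Lemma edge_decoration_mull (T U : tree) a w :
  edge_decoration T a -> U <> Leaf ->
  edge_decoration U (unitization_embed w * a)%g.
Proof.
case: U => // y b1 b2 Ul Ur; case: T => /= [-> _|_ _ _ _ _ [v ->] _].
  by exists w; rewrite mulg1.
by exists (w * v)%g; rewrite unitization_embedM.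
Qed.

(* The cases in which T prec_w U and T succ_w U are mathematically defined. *)
Definition op_index (w : Omega1) (T U : tree) : Prop :=
  match T, U with
  | Leaf, Leaf => False
  | Graft _ _ _ _ _, Graft _ _ _ _ _ =>
      exists v : Omega, w = unitization_embed v
  | _, _ => True
  end.

Lemma op_index_edge T U w :
  edge_decoration T w -> U <> Leaf -> op_index w T U /\ op_index w U T.
Proof. by case: T => [|? ? ? ? ?]; case: U. Qed.

Lemma in_DD_tree_ops T U w :
    well_decorated T -> well_decorated U -> op_index w T U ->
  tree_prec w T U \in in_DD /\ tree_succ w T U \in in_DD.
Proof.
elim: T U w => [|x a1 a2 Tl _ Tr IHT] U w.
  by case: U => // y b1 b2 Ul Ur _ wU _; split; [exact: rpred0 | exact: in_DD_basis].
move=> wT wU; have [ea1 ea2 wTl wTr] := wT; set T := Graft _ _ _ _ _ in wT *.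
have TL : T <> Leaf by [].
have in_prec V v : well_decorated V -> op_index v T V -> tree_prec v T V \in in_DD.
  case: V => [|y b1 b2 Vl Vr] wV; first by move=> _; exact: in_DD_basis.
  case=> {}v ->; rewrite tree_precE; set V := Graft y _ _ _ _ in wV *.
  have VL : V <> Leaf by [].
  apply: in_DD_graft => S => [/msupp_free_basis -> //|].
  have [oa2 _] := op_index_edge ea2 VL.
  have ov : op_index (unitization_embed v) Tr V by case: (Tr) => //= *; exists v.
  have /in_DDP h := rpredD (IHT _ _ wTr wV ov).1 (IHT _ _ wTr wV oa2).2.
  move=> /h[wS SL]; split=> //; exact: edge_decoration_mulr ea2 SL.
move=> ow; split; first exact: in_prec.
elim: U wU ow => [|y b1 b2 Ul IHU Ur _] wU; first by move=> _; exact: rpred0.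
case=> v wE; rewrite {w}wE in IHU *; have [eb1 eb2 wUl wUr] := wU; rewrite tree_succE.
apply: in_DD_graft => S => [|/msupp_free_basis -> //].
have [_ ob1] := op_index_edge eb1 TL.
have ov : op_index (unitization_embed v) T Ul by case: (Ul) => //= *; exists v.
have /in_DDP h := rpredD (in_prec _ _ wUl ob1) (IHU wUl ov).
by move=> /h[wS SL]; split=> //; exact: edge_decoration_mull eb1 SL.
Qed.

Lemma in_DD_prec (w : Omega) (u v : DD) :
  bilinear_extension (tree_prec (unitization_embed w)) (DD_val u) (DD_val v)
    \in in_DD.
Proof.
apply: in_DD_bilinear_extension => T U /(in_DDP _ (DD_valP u))[wT TL].
move=> /(in_DDP _ (DD_valP v))[wU UL]; apply: (in_DD_tree_ops _ _ _).1 => //.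
by case: T U TL UL {wT wU} => [|? ? ? ? ?] [|? ? ? ? ?] //=; exists w.
Qed.

Lemma in_DD_succ (w : Omega) (u v : DD) :
  bilinear_extension (tree_succ (unitization_embed w)) (DD_val u) (DD_val v)
    \in in_DD.
Proof.
apply: in_DD_bilinear_extension => T U /(in_DDP _ (DD_valP u))[wT TL].
move=> /(in_DDP _ (DD_valP v))[wU UL]; apply: (in_DD_tree_ops _ _ _).2 => //.
by case: T U TL UL {wT wU} => [|? ? ? ? ?] [|? ? ? ? ?] //=; exists w.
Qed.

Definition DD_prec (w : Omega) (u v : DD) : DD := MkDD (in_DD_prec w u v).
Definition DD_succ (w : Omega) (u v : DD) : DD := MkDD (in_DD_succ w u v).

Definition one_vertex_trees (u : DD) : Prop :=
  exists x : X, DD_val u = free_basis (Graft x 1%g 1%g Leaf Leaf).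

End Operations.

Arguments one_vertex_trees {k X Omega} u.

(* Main.v *)
(** Everything reduces to basis trees by multilinearity.  On trees, the middle
    axiom is immediate from the recursive definitions; the first axiom for
    (T, U, V) follows from the three axioms for (T^r, U, V), and the third from
    the three axioms for (T, U, V^l).  The recursion reaches leaves, so the
    axioms are proved for T or V a leaf as well, with the type of that leaf
    forced to be 1.  Generation comes from
    T^l \/_{x,(a,b)} T^r = (T^l succ_a (| \/_x |)) prec_b T^r. *)
Require Import Defs.
From mathcomp Require Import all_boot all_algebra.
From mathcomp Require Import finmap.
From mathcomp.multinomials Require Import monalg.

Set Implicit Arguments.
Unset Strict Implicit.
Unset Printing Implicit Defensive.

Import GRing.Theory.
Local Open Scope ring_scope.

(** * Free modules and bilinear extensions *)

Section FreeModuleTheory.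
Variables (k : comPzRingType) (B C E : choiceType).

Lemma free_moduleE (u : free_module k B) :
  u = \sum_(b <- msupp u) u@_b *: free_basis b.
Proof.
rewrite [LHS]monalgE; apply: eq_bigr => b _; apply/malgP => d.
by rewrite free_scaleE !mcoeffU mulr_natr.
Qed.

(** Induction along the basis expansion of [u]. Each basis element met lies in the support of the
    fixed [u], so properties known only on that support can be used in the step. *)
Lemma free_module_msupp_ind (Q : free_module k B -> Prop) u :
  Q 0 ->
  (forall c b v, b \in msupp u -> Q v -> Q (c *: free_basis b + v)) -> Q u.
Proof.
move=> Q0 QD; rewrite (free_moduleE u) big_seq.
by elim/big_rec: _ => // b v bu; apply: QD.
Qed.

Lemma free_module_ind (Q : free_module k B -> Prop) :
  Q 0 -> (forall c b v, Q v -> Q (c *: free_basis b + v)) -> forall u, Q u.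
Proof.
by move=> Q0 QD u; apply: free_module_msupp_ind => // c b v _; apply: QD.
Qed.

Variable f : B -> C -> free_module k E.
Local Notation ext := (bilinear_extension f).

(** Indices outside a support contribute zero coefficients. Linearity compares sums over several
    different supports, and a common finite index set makes them comparable term by term. *)
Lemma bilinear_extension_widen (D1 : {fset B}) (D2 : {fset C}) u v :
  (msupp u `<=` D1)%fset -> (msupp v `<=` D2)%fset ->
  ext u v = \sum_(b <- D1) \sum_(c <- D2) (u@_b * v@_c) *: f b c.
Proof.
move=> uD vD; rewrite /bilinear_extension (big_fset_incl _ uD) /=.
  apply: eq_bigr => b _; apply: big_fset_incl => // c _.
  by move/mcoeff_outdom => ->; rewrite mulr0 scale0r.
move=> b _ /mcoeff_outdom ->; apply: big1 => c _.
by rewrite mul0r scale0r.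
Qed.

Lemma bilinear_extensionPl c u u' v :
  ext (c *: u + u') v = c *: ext u v + ext u' v.
Proof.
pose D := (msupp (c *: u + u') `|` (msupp u `|` msupp u'))%fset.
rewrite !(@bilinear_extension_widen D (msupp v)) ?fsubset_refl //; last first.
- exact: fsubsetUl.
- by rewrite fsubsetU // fsubsetUl orbT.
- by rewrite fsubsetU // fsubsetUr orbT.
rewrite scaler_sumr -big_split; apply: eq_bigr => b _.
rewrite scaler_sumr -big_split; apply: eq_bigr => d _ /=.
by rewrite mcoeffD free_scaleE mulrDl scalerDl scalerA mulrA.
Qed.

Lemma bilinear_extensionPr c u v v' :
  ext u (c *: v + v') = c *: ext u v + ext u v'.
Proof.
pose D := (msupp (c *: v + v') `|` (msupp v `|` msupp v'))%fset.
rewrite !(@bilinear_extension_widen (msupp u) D) ?fsubset_refl //; last first.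
- exact: fsubsetUl.
- by rewrite fsubsetU // fsubsetUl orbT.
- by rewrite fsubsetU // fsubsetUr orbT.
rewrite scaler_sumr -big_split; apply: eq_bigr => b _.
rewrite scaler_sumr -big_split; apply: eq_bigr => d _ /=.
by rewrite mcoeffD free_scaleE mulrDr scalerDl scalerA mulrCA.
Qed.

Lemma bilinear_extension0l v : ext 0 v = 0.
Proof. by rewrite /bilinear_extension msupp0 big_nil. Qed.

Lemma bilinear_extension0r u : ext u 0 = 0.
Proof. by apply: big1 => b _; rewrite msupp0 big_nil. Qed.

Lemma bilinear_extensionDl u u' v : ext (u + u') v = ext u v + ext u' v.
Proof. by have := bilinear_extensionPl 1 u u' v; rewrite !scale1r. Qed.

Lemma bilinear_extensionDr u v v' : ext u (v + v') = ext u v + ext u v'.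
Proof. by have := bilinear_extensionPr 1 u v v'; rewrite !scale1r. Qed.

Lemma bilinear_extension_basis b c : ext (free_basis b) (free_basis c) = f b c.
Proof.
rewrite (@bilinear_extension_widen [fset b]%fset [fset c]%fset) ?msuppU_le //.
by rewrite !big_seq_fset1 !mcoeffUU mulr1 scale1r.
Qed.

End FreeModuleTheory.

(** * The operations on the span of all trees *)

Section Trees.
Variables (k : comPzRingType) (X : Type) (Omega : semigroupType).
Local Notation Omega1 := (unitization Omega).
Local Notation tree := (tree X Omega1).
Local Notation kT := (free_module k tree).
Local Notation leaf := (free_basis (Leaf : tree) : kT).

(** The leaf is kept among the basis trees and the index ranges over all of [Omega1], because the
    recursion calls the operations on subtrees that may be leaves, with edge types that may be 1. *)
Definition kprec (w : Omega1) : kT -> kT -> kT :=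
  bilinear_extension (tree_prec k w).
Definition ksucc (w : Omega1) : kT -> kT -> kT :=
  bilinear_extension (tree_succ k w).

Definition ext0E := (bilinear_extension0l, bilinear_extension0r, addr0).

Lemma graft_basis x a b (T U : tree) :
  graft x a b (free_basis T) (free_basis U)
    = free_basis (Graft x a b T U) :> kT.
Proof. exact: bilinear_extension_basis. Qed.

Lemma kprecDl w (u v z : kT) : kprec w (u + v) z = kprec w u z + kprec w v z.
Proof. exact: bilinear_extensionDl. Qed.

Lemma kprecDr w (u v z : kT) : kprec w z (u + v) = kprec w z u + kprec w z v.
Proof. exact: bilinear_extensionDr. Qed.

Lemma ksuccDr w (u v z : kT) : ksucc w z (u + v) = ksucc w z u + ksucc w z v.
Proof. exact: bilinear_extensionDr. Qed.

Lemma kprec_leafl w (u : kT) : kprec w leaf u = 0.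
Proof.
rewrite /kprec; elim/free_module_ind: u => [|c T u IHu]; first by rewrite ext0E.
by rewrite bilinear_extensionPr IHu bilinear_extension_basis scaler0 addr0.
Qed.

Lemma ksucc_leafr w (u : kT) : ksucc w u leaf = 0.
Proof.
rewrite /ksucc; elim/free_module_ind: u => [|c T u IHu]; first by rewrite ext0E.
rewrite bilinear_extensionPl IHu bilinear_extension_basis.
by rewrite tree_succ_leafr scaler0 addr0.
Qed.

(** * Combinations without the leaf, and the recursive equations for them *)

Definition leafless (u : kT) : bool := Leaf \notin msupp u.

Lemma leafless_msupp (u : kT) T : leafless u -> T \in msupp u -> T <> Leaf.
Proof. by move=> uL Tu TL; move: uL; rewrite /leafless -TL Tu. Qed.

Lemma leafless_linear c (u v : kT) :
  leafless u -> leafless v -> leafless (c *: u + v).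
Proof.
rewrite /leafless -!mcoeff_eq0 mcoeffD free_scaleE => /eqP -> /eqP ->.
by rewrite mulr0 addr0.
Qed.

Lemma leaflessD (u v : kT) : leafless u -> leafless v -> leafless (u + v).
Proof. by move=> uL vL; rewrite -[u]scale1r leafless_linear. Qed.

Lemma leafless0 : leafless 0.
Proof. by rewrite /leafless msupp0. Qed.

Lemma leafless_basis (T : tree) : T <> Leaf -> leafless (free_basis T).
Proof. by move=> TL; apply/negP => /msupp_free_basis /esym. Qed.

Lemma leafless_graft x a b (u v : kT) : leafless (graft x a b u v).
Proof.
rewrite /graft.
elim/free_module_ind: u => [|c T u IHu]; first by rewrite ext0E leafless0.
rewrite bilinear_extensionPl; apply: leafless_linear => {IHu} //.
elim/free_module_ind: v => [|c' U v IHv]; first by rewrite ext0E leafless0.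
rewrite bilinear_extensionPr; apply: leafless_linear => {IHv} //.
by rewrite bilinear_extension_basis; apply: leafless_basis.
Qed.

Lemma kprec_leafr w (u : kT) : leafless u -> kprec w u leaf = u.
Proof.
move=> uL; rewrite /kprec.
(* Only the occurrences in the goal vary; the original [u] stays, so [uL] applies to every tree of
   its support. *)
elim/free_module_msupp_ind: {1 2}u => [|c T v Tu IHv].
  by rewrite ext0E.
rewrite bilinear_extensionPl IHv bilinear_extension_basis tree_prec_leafr //.
exact: leafless_msupp Tu.
Qed.

Lemma ksucc_leafl w (u : kT) : leafless u -> ksucc w leaf u = u.
Proof.
move=> uL; rewrite /ksucc.
elim/free_module_msupp_ind: {1 2}u => [|c T v Tu IHv].
  by rewrite ext0E.
rewrite bilinear_extensionPr IHv bilinear_extension_basis tree_succ_leafl //.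
exact: leafless_msupp Tu.
Qed.

(** Clause (b) of the recursion, extended linearly: [u] and [v] may contain the leaf, since (b)
    allows leaves as subtrees. The leaf is excluded from [z], where clause (a) takes over and leaves
    the edge type [b] unchanged. *)
Lemma kprec_graft w x a b (u v z : kT) : leafless z ->
  kprec w (graft x a b u v) z =
  graft x a (b * w)%g u (kprec w v z + ksucc b v z).
Proof.
move=> zL; rewrite /kprec /ksucc /graft.
elim/free_module_msupp_ind: {1 2 3}z => [|e V z' Vz IHz].
  by rewrite !ext0E.
rewrite !bilinear_extensionPr IHz addrACA -scalerDr bilinear_extensionPr.
congr (_ *: _ + _) => {IHz z'}.
elim/free_module_ind: u => [|c T u IHu]; first by rewrite !ext0E.
rewrite !bilinear_extensionPl IHu; congr (_ *: _ + _).
elim/free_module_ind: v {IHu} => [|d U v IHv]; first by rewrite !ext0E.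
rewrite !(bilinear_extensionPl, bilinear_extensionPr) IHv.
rewrite addrACA -scalerDr bilinear_extensionPr; congr (_ *: _ + _).
by case: V Vz {IHv} (leafless_msupp zL Vz) => // *;
  rewrite !bilinear_extension_basis.
Qed.

Lemma ksucc_graft w y a b (u v z : kT) : leafless z ->
  ksucc w z (graft y a b u v) =
  graft y (w * a)%g b (kprec a z u + ksucc w z u) v.
Proof.
move=> zL; rewrite /kprec /ksucc /graft.
elim/free_module_msupp_ind: {1 2 3}z => [|e T z' Tz IHz].
  by rewrite !ext0E.
rewrite !bilinear_extensionPl IHz addrACA -scalerDr bilinear_extensionPl.
congr (_ *: _ + _) => {IHz z'}.
elim/free_module_ind: v => [|c V v IHv]; first by rewrite !ext0E.
rewrite !bilinear_extensionPr IHv; congr (_ *: _ + _).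
elim/free_module_ind: u {IHv} => [|d U u IHu]; first by rewrite !ext0E.
rewrite !(bilinear_extensionPl, bilinear_extensionPr) IHu.
rewrite addrACA -scalerDr bilinear_extensionPl; congr (_ *: _ + _).
by case: T Tz {IHu} (leafless_msupp zL Tz) => // *;
  rewrite !bilinear_extension_basis.
Qed.

(** * The axioms on basis trees *)

(** [T] acts only on the left branch of [U] and [V] only on its right branch, so the two actions
    commute. *)
Lemma succ_prec_basis (a b : Omega1) (T U V : tree) : U <> Leaf ->
  kprec b (ksucc a (free_basis T) (free_basis U)) (free_basis V) =
  ksucc a (free_basis T) (kprec b (free_basis U) (free_basis V)).
Proof.
case: U => // y b1 b2 Ul Ur _; rewrite -graft_basis; set u := graft _ _ _ _ _.
have uL : leafless u by apply: leafless_graft.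
have [->|/eqP/leafless_basis TL] := eqVneq T Leaf;
  have [->|/eqP/leafless_basis VL] := eqVneq V Leaf.
- by rewrite ksucc_leafl // kprec_leafr // ksucc_leafl.
- by rewrite ksucc_leafl // kprec_graft // ksucc_leafl // leafless_graft.
- by rewrite (kprec_leafr _ uL) ksucc_graft // kprec_leafr // leafless_graft.
by rewrite ksucc_graft // !kprec_graft // ksucc_graft.
Qed.

Lemma edge_decoration_leaf (T : tree) a :
  edge_decoration T a -> T = Leaf -> a = 1%g.
Proof. by move=> + TL; rewrite TL. Qed.

(** The two identities are proved together, by induction on [T] for all [V], then on [V] for fixed
    [T], because each inductive step uses both. The conditions at leaves are those met by edges of
    well-decorated trees: for a leaf [V], the first identity compares the indices [a] and [a * b],
    which agree when [b] is 1; a leaf [T] is symmetric. *)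
Lemma dendriform_basis (T U V : tree) :
    well_decorated T -> well_decorated V -> U <> Leaf ->
  forall a b : Omega1,
  ((V = Leaf -> b = 1%g) ->
    kprec b (kprec a (free_basis T) (free_basis U)) (free_basis V) =
    kprec (a * b)%g (free_basis T) (kprec b (free_basis U) (free_basis V)
      + ksucc a (free_basis U) (free_basis V))) /\
  ((T = Leaf -> a = 1%g) ->
    ksucc (a * b)%g (kprec b (free_basis T) (free_basis U)
      + ksucc a (free_basis T) (free_basis U)) (free_basis V) =
    ksucc a (free_basis T) (ksucc b (free_basis U) (free_basis V))).
Proof.
move=> + + UL0; have := @succ_prec_basis _ _ _ _ _ UL0.
case: U UL0 => // y b1 b2 Ul Ur _; rewrite -graft_basis.
set u := graft _ _ _ _ _ => succ_prec_u.
have uL : leafless u by apply: leafless_graft.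
elim: T V => [|x a1 a2 Tl _ Tr IHT].
  (* For the leaf [T], both sides of the first identity vanish; in the other one, [a = 1] reduces
     the index [a * b] to [b]. *)
  move=> V _ _ a b; split=> [_|/(_ erefl) ->]; rewrite !kprec_leafl //.
    by rewrite /kprec ext0E.
  rewrite mul1g add0r ksucc_leafl //; case: V => [|z c1 c2 Vl Vr].
    by rewrite !ksucc_leafr /ksucc ext0E.
  by rewrite -graft_basis ksucc_graft // ksucc_leafl ?leafless_graft.
move=> + wT; have [_ ea2 _ wTr] := wT; set T := Graft _ _ _ _ _ in wT *.
have TL : leafless (free_basis T) by apply: leafless_basis.
elim=> [_|z c1 c2 Vl IHV Vr _ wV] a b.
  split=> [/(_ erefl) ->|_]; last by rewrite !ksucc_leafr /ksucc ext0E.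
  rewrite ksucc_leafr addr0 mulg1 (kprec_leafr _ uL).
  by rewrite -graft_basis kprec_graft // kprec_leafr // leafless_graft.
have [ec1 _ wVl _] := wV.
split=> _.
  set V := Graft _ _ _ _ _ in wV *.
  have VL : leafless (free_basis V) by apply: leafless_basis.
  have uVL : leafless (kprec b u (free_basis V) + ksucc a u (free_basis V)).
    apply: leaflessD; first by rewrite kprec_graft ?leafless_graft.
    by rewrite /V -graft_basis ksucc_graft ?leafless_graft.
  rewrite -graft_basis (kprec_graft _ _ _ _ _ _ uL).
  rewrite (kprec_graft _ _ _ _ _ _ VL).
  rewrite (kprec_graft _ _ _ _ _ _ uVL).
  (* Both sides are now grafts with left branch [Tl]. Their right branches agree by the first axiom
     for [Tr] at [(a, b)], the middle one at [(a2, b)] and the third at [(a2, a)]; [ea2] covers the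
     case of a leaf [Tr]. *)
  rewrite kprecDl (IHT V wTr wV a b).1 // succ_prec_u ksuccDr.
  rewrite mulgA addrA (IHT V wTr wV a2 a).2 //.
  exact: edge_decoration_leaf ea2.
have TuL : leafless (kprec b (free_basis T) u + ksucc a (free_basis T) u).
  apply: leaflessD; last by rewrite ksucc_graft ?leafless_graft.
  by rewrite /T -graft_basis kprec_graft ?leafless_graft.
rewrite -[free_basis (Graft z _ _ _ _)]graft_basis.
rewrite (ksucc_graft _ _ _ _ _ _ uL) (ksucc_graft _ _ _ _ _ _ TuL).
rewrite (ksucc_graft _ _ _ _ _ _ TL).
(* Mirror image in the left branch: the first axiom for [Vl] at [(b, c1)], the middle one at
   [(a, c1)] and the third at [(a, b)]. *)
rewrite kprecDl (IHV wVl b c1).1; last exact: edge_decoration_leaf ec1.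
by rewrite succ_prec_u (IHV wVl a b).2 // kprecDr ksuccDr mulgA !addrA.
Qed.

(** * From basis trees to linear combinations *)

Lemma kopPl w c (u v z : kT) :
  (kprec w (c *: u + v) z = c *: kprec w u z + kprec w v z) *
  (ksucc w (c *: u + v) z = c *: ksucc w u z + ksucc w v z).
Proof. by split; apply: bilinear_extensionPl. Qed.

Lemma kopPr w c (u v z : kT) :
  (kprec w z (c *: u + v) = c *: kprec w z u + kprec w z v) *
  (ksucc w z (c *: u + v) = c *: ksucc w z u + ksucc w z v).
Proof. by split; apply: bilinear_extensionPr. Qed.

Definition trilinear (F : kT -> kT -> kT -> kT) : Prop :=
  [/\ forall v z, linear (fun u => F u v z),
      forall u z, linear (fun v => F u v z)
    & forall u v, linear (F u v)].

(** Agreement is asked only on the support of [u], since the axioms are available only for suitably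
    decorated trees. *)
Lemma linear_eq_msupp (f g : kT -> kT) (u : kT) : linear f -> linear g ->
  (forall T, T \in msupp u -> f (free_basis T) = g (free_basis T)) -> f u = g u.
Proof.
have lin0 (h : kT -> kT) : linear h -> h 0 = 0.
  (* Linearity at scalar -1 and zero vectors reads h(0) = -h(0) + h(0). *)
  by move=> hP; have := hP (-1) 0 0; rewrite !scaleN1r !addNr.
move=> fP gP fg; elim/free_module_msupp_ind: {1 2}u => [|c T v Tu IHv].
  by rewrite !lin0.
by rewrite fP gP IHv fg.
Qed.

Lemma trilinear_eq F G (u v z : kT) : trilinear F -> trilinear G ->
  (forall T U V, T \in msupp u -> U \in msupp v -> V \in msupp z ->
    F (free_basis T) (free_basis U) (free_basis V) =
    G (free_basis T) (free_basis U) (free_basis V)) ->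
  F u v z = G u v z.
Proof.
move=> [F1 F2 F3] [G1 G2 G3] FG.
apply: (linear_eq_msupp (F1 v z) (G1 v z)) => T Tu.
apply: (linear_eq_msupp (F2 _ z) (G2 _ z)) => U Uv.
by apply: (linear_eq_msupp (F3 _ _) (G3 _ _)) => V Vz; apply: FG.
Qed.

(** Membership in [in_DD] makes every tree of the three supports well decorated and different from
    the leaf, so the conditions at leaves in [dendriform_basis] hold vacuously. *)
Lemma dendriform_kT (a b : Omega1) (u v z : kT) :
  u \in @in_DD k X Omega -> v \in @in_DD k X Omega -> z \in @in_DD k X Omega ->
  [/\ kprec b (kprec a u v) z = kprec (a * b)%g u (kprec b v z + ksucc a v z),
    kprec b (ksucc a u v) z = ksucc a u (kprec b v z)
  & ksucc (a * b)%g (kprec b u v + ksucc a u v) z = ksucc a u (ksucc b v z)].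
Proof.
move=> /in_DDP uP /in_DDP vP /in_DDP zP; split.
- apply: (trilinear_eq (F := fun u v z => kprec b (kprec a u v) z)
    (G := fun u v z => kprec (a * b)%g u (kprec b v z + ksucc a v z))).
  + by split=> ? ? c ? ?; rewrite ?(kopPl, kopPr).
  + by split=> ? ? c ? ?; rewrite ?(kopPl, kopPr) // addrACA -scalerDr kopPr.
  by move=> T U V /uP[wT TL] /vP[_ UL] /zP[wV VL];
    apply: (dendriform_basis wT wV UL _ _).1.
- apply: (trilinear_eq (F := fun u v z => kprec b (ksucc a u v) z)
    (G := fun u v z => ksucc a u (kprec b v z))).
  + by split=> ? ? c ? ?; rewrite ?(kopPl, kopPr).
  + by split=> ? ? c ? ?; rewrite ?(kopPl, kopPr).
  by move=> T U V _ /vP[_ UL] _; apply: succ_prec_basis.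
apply: (trilinear_eq
    (F := fun u v z => ksucc (a * b)%g (kprec b u v + ksucc a u v) z)
    (G := fun u v z => ksucc a u (ksucc b v z))).
- by split=> ? ? c ? ?; rewrite ?(kopPl, kopPr) // addrACA -scalerDr kopPl.
- by split=> ? ? c ? ?; rewrite ?(kopPl, kopPr).
by move=> T U V /uP[wT TL] /vP[_ UL] /zP[wV VL];
    apply: (dendriform_basis wT wV UL _ _).2.
Qed.

(** * The dendriform family algebra structure on DD *)

Local Notation DD := (DD k X Omega).

Lemma DD_val_linear c (u v : DD) :
  DD_val (c *: u + v) = c *: DD_val u + DD_val v.
Proof. exact: linearP (\val : DD -> kT) c u v. Qed.

Lemma DD_val_inj : injective (@DD_val k X Omega).
Proof. exact: val_inj. Qed.

Lemma DD_dendriform :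
  dendriform_family_algebra (@DD_prec k X Omega) (@DD_succ k X Omega).
Proof.
split=> [w|w|a b u v z|a b u v z|a b u v z].
- split=> v c x y; apply: DD_val_inj; rewrite DD_val_linear.
    by rewrite -(kopPl _ _ _ _ _).1 -DD_val_linear.
  by rewrite -(kopPr _ _ _ _ _).1 -DD_val_linear.
- split=> v c x y; apply: DD_val_inj; rewrite DD_val_linear.
    by rewrite -(kopPl _ _ _ _ _).2 -DD_val_linear.
  by rewrite -(kopPr _ _ _ _ _).2 -DD_val_linear.
- apply: DD_val_inj => /=; rewrite unitization_embedM.
  by have [] := dendriform_kT (unitization_embed a) (unitization_embed b)
    (DD_valP u) (DD_valP v) (DD_valP z).
- apply: DD_val_inj => /=.
  by have [] := dendriform_kT (unitization_embed a) (unitization_embed b)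
    (DD_valP u) (DD_valP v) (DD_valP z).
apply: DD_val_inj => /=; rewrite unitization_embedM.
by have [] := dendriform_kT (unitization_embed a) (unitization_embed b)
    (DD_valP u) (DD_valP v) (DD_valP z).
Qed.

(** * Generation by the one-vertex trees *)

Lemma DD_generated : dfa_generated_by (@DD_prec k X Omega) (@DD_succ k X Omega)
    one_vertex_trees.
Proof.
move=> P [P0 PZD Pprec Psucc] Pgen.
(* [P] is transported to the span of all trees, where the graft equations are stated. *)
pose Q (v : kT) := exists2 d : DD, DD_val d = v & P d.
have Qprec w u v : Q u -> Q v -> Q (kprec (unitization_embed w) u v).
  by move=> [d <- Pd] [e <- Pe]; exists (DD_prec w d e) => //; apply: Pprec.
have Qsucc w u v : Q u -> Q v -> Q (ksucc (unitization_embed w) u v).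
  by move=> [d <- Pd] [e <- Pe]; exists (DD_succ w d e) => //; apply: Psucc.
have Qbasis (T : tree) : well_decorated T -> T <> Leaf -> Q (free_basis T).
  elim: T => // x a b Tl IHl Tr IHr [ea eb wTl wTr] _.
  have Qx : Q (graft x 1%g 1%g leaf leaf).
    have wx : well_decorated (Graft x 1%g 1%g Leaf Leaf : tree) by [].
    have xL : Graft x 1%g 1%g Leaf Leaf <> Leaf :> tree by [].
    rewrite graft_basis; exists (MkDD (in_DD_basis k wx xL)) => //.
    by apply: Pgen; exists x.
  (* For [Tl] a leaf, [a = 1] and this is [Qx]. Otherwise it is [Tl] succ the one-vertex tree: in
     the left branch [Tl] prec the leaf gives [Tl], and [Tl] succ the leaf gives 0. *)
  have Ql : Q (graft x a 1%g (free_basis Tl) leaf).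
    case: Tl ea wTl IHl => [-> //|y c1 c2 S1 S2 [w ->] wS IHS].
    have SL : leafless (free_basis (Graft y c1 c2 S1 S2)).
      by apply: leafless_basis.
    have := Qsucc w _ _ (IHS wS _) Qx.
    by rewrite ksucc_graft // mulg1 kprec_leafr // ksucc_leafr addr0; apply.
  rewrite -graft_basis.
  (* Likewise on the right: for [Tr] not a leaf, the tree of [Ql] prec [Tr] replaces the right leaf
     by 0 plus [Tr], with edge type [1 * b]. *)
  case: Tr eb wTr IHr => [-> //|y c1 c2 S1 S2 [w ->] wS IHS].
  have SL : leafless (free_basis (Graft y c1 c2 S1 S2)).
    by apply: leafless_basis.
  have := Qprec w _ _ Ql (IHS wS _).
  by rewrite kprec_graft // mul1g kprec_leafl ksucc_leafl // add0r; apply.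
move=> u; suff [d /DD_val_inj <-] : Q (DD_val u) by [].
elim/free_module_msupp_ind: {1}(DD_val u) => [|c T v Tu [d <- Pd]].
  by exists 0.
have [wT TL] := in_DDP _ (DD_valP u) T Tu.
have [e <- Pe] := Qbasis T wT TL.
by exists (c *: e + d); [rewrite DD_val_linear | apply: PZD].
Qed.

End Trees.

Theorem proposition3p10 (k : comPzRingType) (X : Type) (Omega : semigroupType) :
  dendriform_family_algebra (@DD_prec k X Omega) (@DD_succ k X Omega) /\
  dfa_generated_by (@DD_prec k X Omega) (@DD_succ k X Omega)
    one_vertex_trees.
Proof. by split; [apply: DD_dendriform | apply: DD_generated]. Qed.
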